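(* Let $G$ be a finite group and $n\geq 1$. Let $\rho^1$ and $\rho^2$ be two positive representations of $G$ in $\mathbb{R}^n$, given by $\rho^i_s=m_i\,\pi^i_s\,m_i^{-1}$ for all $s\in G$, where $m_i\in(\mathbb{R}_{>0})^n$ and $\pi^i\colon G\to S_n$ is a permutation representation, for $i=1,2$. Then $\rho^1$ and $\rho^2$ are order equivalent if and only if $\pi^1$ and $\pi^2$ are permutation equivalent.
   Context: $\mathbb{R}^n$ carries the coordinatewise ordering and $\mathrm{Aut}^+(\mathbb{R}^n)$ is its group of lattice automorphisms. A positive representation of $G$ in $\mathbb{R}^n$ is a group homomorphism $\rho\colon G\to\mathrm{Aut}^+(\mathbb{R}^n)$, $s\mapsto\rho_s$. The group $S_n$ is identified with the subgroup of permutation operators in $\mathrm{Aut}^+(\mathbb{R}^n)$: $\sigma\in S_n$ corresponds to $e_i\mapsto e_{\sigma(i)}$, where $e_1,\dots,e_n$ is the standard basis. An element $m\in(\mathbb{R}_{>0})^n$ is identified with the diagonal operator $e_i\mapsto m_ie_i$. A permutation representation is a group homomorphism $G\to S_n\subset\mathrm{Aut}^+(\mathbb{R}^n)$. Every positive representation of a finite group in $\mathbb{R}^n$ can be written as $\rho_s=m\pi_sm^{-1}$ with $\pi$ a (unique) permutation representation and $m\in(\mathbb{R}_{>0})^n$. Two positive representations $\rho,\theta$ of $G$ in $\mathbb{R}^n$ are order equivalent if there is $T\in\mathrm{Aut}^+(\mathbb{R}^n)$ with $\rho_sT=T\theta_s$ for all $s\in G$; they are permutation equivalent if such a $T$ exists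 in $S_n$. *)

(* Defs.v *)
From HB Require Import structures.
From mathcomp Require Import all_boot all_order all_algebra all_fingroup.
From mathcomp Require Import mxrepresentation.
From mathcomp Require Import reals.
Set Implicit Arguments.
Unset Strict Implicit.
Unset Printing Implicit Defensive.
Import Order.TTheory GRing.Theory Num.Theory.
Local Open Scope ring_scope.

(* Vectors of R^n are columns 'cV[R]_n and operators are matrices acting on the
   left, v |-> A *m v, so composition of operators is *m in the usual order. *)

Definition joinv (R : realType) (n : nat) (x y : 'cV[R]_n) : 'cV[R]_n :=
  map2_mx Num.max x y.

Definition meetv (R : realType) (n : nat) (x y : 'cV[R]_n) : 'cV[R]_n :=
  map2_mx Num.min x y.

Definition lattice_aut (R : realType) (n : nat) (T : 'M[R]_n) : Prop :=
  [/\ T \in unitmx,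
      forall x y : 'cV[R]_n, T *m joinv x y = joinv (T *m x) (T *m y) &
      forall x y : 'cV[R]_n, T *m meetv x y = meetv (T *m x) (T *m y)].

(* [perm_mx s] sends the i-th basis row to the (s i)-th one by right
   multiplication; on columns this is the operator of s^-1, see [permopE]. *)
Definition permop (R : realType) (n : nat) (s : 'S_n) : 'M[R]_n :=
  perm_mx s^-1%g.

Definition diagop (R : realType) (n : nat) (m : 'cV[R]_n) : 'M[R]_n :=
  diag_mx m^T.

Definition positive_repr (R : realType) (gT : finGroupType) (G : {group gT})
    (n : nat) (rho : gT -> 'M[R]_n) : Prop :=
  mx_repr G rho /\ {in G, forall s, lattice_aut (rho s)}.

(* Homomorphism for composition of permutations from right to left, whereas the
   product of 'S_n composes from left to right. *)
Definition perm_repr (gT : finGroupType) (G : {group gT}) (n : nat)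
    (pi : gT -> 'S_n) : Prop :=
  {in G &, forall s t, forall i, pi (s * t)%g i = pi s (pi t i)}.

Definition order_equivalent (R : realType) (gT : finGroupType)
    (G : {group gT}) (n : nat) (rho theta : gT -> 'M[R]_n) : Prop :=
  exists T : 'M[R]_n,
    lattice_aut T /\ {in G, forall s, rho s *m T = T *m theta s}.

Definition permutation_equivalent (R : realType) (gT : finGroupType)
    (G : {group gT}) (n : nat) (rho theta : gT -> 'M[R]_n) : Prop :=
  exists sigma : 'S_n,
    {in G, forall s, rho s *m permop R sigma = permop R sigma *m theta s}.

Lemma permopE (R : realType) (n : nat) (s : 'S_n) (i : 'I_n) :
  permop R s *m delta_mx i 0 = delta_mx (s i) 0 :> 'cV[R]_n.
Proof.
apply/colP => j; rewrite -colE !mxE eqxx andbT; congr (_%:R).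
by rewrite -(inj_eq (@perm_inj _ s)) permKV.
Qed.

Lemma diagopE (R : realType) (n : nat) (m : 'cV[R]_n) (i : 'I_n) :
  diagop m *m delta_mx i 0 = m i 0 *: delta_mx i 0 :> 'cV[R]_n.
Proof.
apply/colP => j; rewrite -colE !mxE eqxx andbT.
by case: eqVneq => [->|_]; rewrite ?mulr1n ?mulr1 ?mulr0n ?mulr0.
Qed.

Lemma permop_aut (R : realType) (n : nat) (s : 'S_n) :
  lattice_aut (permop R s).
Proof.
split; first exact: unitmx_perm.
- by move=> x y; apply/colP => i; rewrite -!row_permE !mxE.
- by move=> x y; apply/colP => i; rewrite -!row_permE !mxE.
Qed.

Lemma perm_repr_positive (R : realType) (gT : finGroupType) (G : {group gT})
    (n : nat) (pi : gT -> 'S_n) :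
  perm_repr G pi -> positive_repr G (fun s => permop R (pi s)).
Proof.
move=> hpi; split; last by move=> s _; exact: permop_aut.
split.
  have -> : pi 1%g = 1%g.
    apply/permP => i; apply: (@perm_inj _ (pi 1%g)).
    by rewrite -(hpi _ _ (group1 G) (group1 G)) mulg1 perm1.
  by rewrite /permop invg1 perm_mx1.
move=> s t sG tG; rewrite /permop -perm_mxM -invMg; congr (perm_mx _^-1).
by apply/permP => i; rewrite permM hpi.
Qed.

(* Main.v *)
(* Conjugation by the diagonal operators, which are lattice automorphisms,
   reduces order equivalence of rho1 and rho2 to that of pi1 and pi2. A lattice
   automorphism T intertwining pi1 and pi2 sends disjoint basis vectors to
   disjoint vectors, so its nonzero entries sit at the positions (sigma j, j)
   of a permutation sigma. The intertwining relation says that the entries of T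
   are constant along orbits of (i, j) |-> (pi1 s i, pi2 s j), so this set of
   positions is invariant, which means that sigma intertwines pi1 and pi2. *)
Require Import Defs.
From HB Require Import structures.
From mathcomp Require Import all_boot all_order all_algebra all_fingroup.
From mathcomp Require Import mxrepresentation.
From mathcomp Require Import reals.
Set Implicit Arguments.
Unset Strict Implicit.
Unset Printing Implicit Defensive.
Import Order.TTheory GRing.Theory Num.Theory.
Local Open Scope ring_scope.

Lemma lattice_autM (R : realType) (n : nat) (A B : 'M[R]_n) :
  lattice_aut A -> lattice_aut B -> lattice_aut (A *m B).
Proof.
move=> [uA jA kA] [uB jB kB]; split; first by rewrite unitmx_mul uA uB.
- by move=> x y; rewrite -!mulmxA jB jA.
- by move=> x y; rewrite -!mulmxA kB kA.
Qed.

(** Write [x] and [y] as images under [A]; then [A] commutes with their join and meet, and [invmx A]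
    cancels it. *)
Lemma lattice_autV (R : realType) (n : nat) (A : 'M[R]_n) :
  lattice_aut A -> lattice_aut (invmx A).
Proof.
move=> [uA jA kA]; split; first by rewrite unitmx_inv.
- move=> x y; rewrite -{1}(mulKVmx uA x) -{1}(mulKVmx uA y) -jA.
  by rewrite mulKmx.
- move=> x y; rewrite -{1}(mulKVmx uA x) -{1}(mulKVmx uA y) -kA.
  by rewrite mulKmx.
Qed.

Lemma diagop_aut (R : realType) (n : nat) (m : 'cV[R]_n) :
  (forall i, 0 < m i 0) -> lattice_aut (diagop m).
Proof.
move=> m_gt0; split.
- rewrite unitmxE det_diag unitfE; apply/prodf_neq0 => i _.
  by rewrite mxE gt_eqF.
- by move=> x y; apply/colP => i; rewrite /diagop !mul_diag_mx !mxE
    maxr_pMr ?ltW.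
- by move=> x y; apply/colP => i; rewrite /diagop !mul_diag_mx !mxE
    minr_pMr ?ltW.
Qed.

(** The factors swap because the product of ['S_n] composes from left to right, operators from right
    to left. *)
Lemma permopM (R : realType) (n : nat) (s t : 'S_n) :
  permop R s *m permop R t = permop R (t * s)%g.
Proof. by rewrite /permop invMg perm_mxM. Qed.

Lemma lattice_aut_row_uniq (R : realType) (n : nat) (T : 'M[R]_n) i j k :
  lattice_aut T -> T i j != 0 -> T i k != 0 -> j = k.
Proof.
move=> [_ _ meetT] Tij Tik; apply/eqP/contraT => neq_jk.
have disj : meetv (delta_mx j 0) (delta_mx k 0) = 0 :> 'cV[R]_n.
  apply/colP => l; rewrite !mxE eqxx !andbT.
  have [->|_] := eqVneq l j; last by case: (l == k); rewrite /= ?minxx // min_l.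
  by rewrite (negPf neq_jk) min_r.
(* Coordinate [i] of the image of this zero meet says that the minimum of [T i j] and [T i k] is 0,
   yet it is one of these two nonzero entries. *)
have /colP/(_ i) := meetT (delta_mx j 0) (delta_mx k 0).
rewrite disj mulmx0 -!colE !mxE minEle.
by case: ifP => _ /esym/eqP; rewrite (negPf Tij, negPf Tik).
Qed.

Lemma unitmx_col_neq0 (R : comUnitRingType) (n : nat) (T : 'M[R]_n) j :
  T \in unitmx -> exists i, T i j != 0.
Proof.
move=> uT; apply/existsP/contraT; rewrite negb_exists => /forallP Tj0.
have Tj : T *m delta_mx j 0 = 0 :> 'cV[R]_n.
  by apply/colP => i; rewrite -colE !mxE; apply/eqP/negbNE/Tj0.
have /colP/(_ j)/eqP : delta_mx j 0 = 0 :> 'cV[R]_n.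
  by rewrite -(mulKmx uT (delta_mx j 0)) Tj mulmx0.
by rewrite !mxE !eqxx oner_eq0.
Qed.

(** Invertibility gives each column [j] a nonzero entry, in a chosen row [f j]. No row has two
    nonzero entries, so [f] is injective, hence a permutation of the finite index set. *)
Lemma lattice_aut_support (R : realType) (n : nat) (T : 'M[R]_n) :
  lattice_aut T ->
  exists sigma : 'S_n, forall i j, (T i j != 0) = (i == sigma j).
Proof.
move=> latT; have [uT _ _] := latT.
have Tcol j : exists i, T i j != 0 by exact: unitmx_col_neq0.
pose f j := xchoose (Tcol j).
have Tf j : T (f j) j != 0 by exact: xchooseP (Tcol j).
have f_inj : injective f.
  move=> j k eq_f; apply: (lattice_aut_row_uniq latT (Tf j)).
  by rewrite eq_f Tf.
exists (perm f_inj) => i j; apply/idP/eqP => [Tij | ->]; last by rewrite permE.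
(* Columns [j] and [sigma^-1 i] both have a nonzero entry in row [i], so they coincide. *)
rewrite -(permKV (perm f_inj) i); congr (perm f_inj _).
by apply: (lattice_aut_row_uniq latT _ Tij);
  rewrite -{1}(permKV (perm f_inj) i) permE.
Qed.

Lemma permop_intertwine (R : realType) (n : nat) (T : 'M[R]_n) (s t : 'S_n) :
  permop R s *m T = T *m permop R t -> forall i j, T (s i) (t j) = T i j.
Proof.
rewrite -row_permE -col_permE => /matrixP eqT i j.
by have := eqT (s i) j; rewrite !mxE permK.
Qed.

Lemma conjmx_intertwine (R : comUnitRingType) (n : nat) (D E P Q T : 'M[R]_n) :
  D \in unitmx -> E \in unitmx -> P *m T = T *m Q ->
  D *m P *m invmx D *m (D *m T *m invmx E) =
  D *m T *m invmx E *m (E *m Q *m invmx E).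
Proof.
by move=> uD uE PT; rewrite -!mulmxA !mulKmx // [P *m _]mulmxA PT -!mulmxA.
Qed.

Lemma order_equivalent_permop (R : realType) (gT : finGroupType)
    (G : {group gT}) (n : nat) (pi1 pi2 : gT -> 'S_n) :
  order_equivalent G (fun s => permop R (pi1 s)) (fun s => permop R (pi2 s)) <->
  permutation_equivalent G (fun s => permop R (pi1 s))
                           (fun s => permop R (pi2 s)).
Proof.
split=> [[T [latT eqT]] | [sigma eq_sigma]]; last first.
  by exists (permop R sigma); split=> //; exact: permop_aut.
have [sigma supp] := lattice_aut_support latT.
exists sigma => s sG; rewrite !permopM; congr (permop R _).
apply/permP => j; rewrite !permM; apply/eqP.
(* The entry of [T] at [(pi1 s (sigma j), pi2 s j)] equals the one at [(sigma j, j)], which is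
   nonzero. *)
by rewrite -supp (permop_intertwine (eqT s sG)) supp.
Qed.

(** If [T] intertwines [rho] and [theta], then [D T E^-1] intertwines their conjugates, even for
    different [D] and [E]. *)
Lemma order_equivalent_conj (R : realType) (gT : finGroupType)
    (G : {group gT}) (n : nat) (D E : 'M[R]_n) (rho theta : gT -> 'M[R]_n) :
  lattice_aut D -> lattice_aut E -> order_equivalent G rho theta ->
  order_equivalent G (fun s => D *m rho s *m invmx D)
                     (fun s => E *m theta s *m invmx E).
Proof.
move=> latD latE [T [latT eqT]]; have [uD _ _] := latD; have [uE _ _] := latE.
exists (D *m T *m invmx E); split.
  by apply: lattice_autM; [exact: lattice_autM | exact: lattice_autV].
by move=> s sG; apply: conjmx_intertwine => //; exact: eqT.
Qed.

Lemma eq_order_equivalent (R : realType) (gT : finGroupType)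
    (G : {group gT}) (n : nat) (rho rho' theta theta' : gT -> 'M[R]_n) :
  {in G, rho =1 rho'} -> {in G, theta =1 theta'} ->
  order_equivalent G rho theta -> order_equivalent G rho' theta'.
Proof.
move=> eq_rho eq_theta [T [latT eqT]]; exists T; split=> // s sG.
by rewrite -eq_rho // -eq_theta // eqT.
Qed.

Theorem proposition4p6 (R : realType) (gT : finGroupType) (G : {group gT})
    (n : nat) (hn : (1 <= n)%N)
    (rho1 rho2 : gT -> 'M[R]_n) (m1 m2 : 'cV[R]_n) (pi1 pi2 : gT -> 'S_n)
    (hrho1 : positive_repr G rho1) (hrho2 : positive_repr G rho2)
    (hm1 : forall i, 0 < m1 i 0) (hm2 : forall i, 0 < m2 i 0)
    (hpi1 : perm_repr G pi1) (hpi2 : perm_repr G pi2)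
    (def1 : {in G, forall s,
       rho1 s = diagop m1 *m permop R (pi1 s) *m invmx (diagop m1)})
    (def2 : {in G, forall s,
       rho2 s = diagop m2 *m permop R (pi2 s) *m invmx (diagop m2)}) :
  order_equivalent G rho1 rho2 <->
  permutation_equivalent G (fun s => permop R (pi1 s))
                           (fun s => permop R (pi2 s)).
Proof.
have lat1 := diagop_aut hm1; have lat2 := diagop_aut hm2.
have [u1 _ _] := lat1; have [u2 _ _] := lat2.
apply: iff_trans (order_equivalent_permop R G pi1 pi2); split=> oe.
  (* Conjugating by the inverse diagonals recovers the permutation operators. *)
  have := order_equivalent_conj (lattice_autV lat1) (lattice_autV lat2) oe.
  by apply: eq_order_equivalent => s sG; rewrite (def1, def2) // invmxK -!mulmxA
    mulVmx // mulmx1 mulKmx.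
by apply: eq_order_equivalent (order_equivalent_conj lat1 lat2 oe) => s sG;
  rewrite (def1, def2).
Qed.
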